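(* Let $\Omega=(a,b)$ with real numbers $a<b$. For all grid sizes $h$, each $q\in\mathbb{N}$ and each $p\in\mathbb{N}$ with $0<q\le p+1$, the inequality $$|u_{p,h}|_{H^q(\Omega)}\le 2\sqrt{3}\,h^{-1}\,|u_{p,h}|_{H^{q-1}(\Omega)}$$ is satisfied for all $u_{p,h}\in\widetilde{S}^{(q)}_{p,h}(\Omega)$.
   Context: $\mathbb{N}=\{1,2,3,\ldots\}$, $\mathbb{N}_0=\mathbb{N}\cup\{0\}$. A grid size for $\Omega=(a,b)$ is a real $h>0$ such that $n_h:=h^{-1}(b-a)\in\mathbb{N}$. $H^r(\Omega)$ is the standard Sobolev space ($H^0=L^2$) and $|u|_{H^r(\Omega)}:=\|\frac{\partial^r}{\partial x^r}u\|_{L^2(\Omega)}$ (so $|u|_{H^0(\Omega)}=\|u\|_{L^2(\Omega)}$). $\mathbb{P}^p$ is the space of polynomials of degree (at most) $p$, and $$S_{p,h}(\Omega):=\{u\in H^p(\Omega): u|_{(a+hj,a+h(j+1)]}\in\mathbb{P}^p\text{ for all }j=0,\ldots,n_h-1\}$$ is the space of splines of degree $p$ and maximum smoothness on the uniform grid of size $h$. $\widetilde{S}^{(q)}_{p,h}(\Omega)$ is the space of all $u_{p,h}\in S_{p,h}(\Omega)$ satisfying $$\frac{\partial^{2l+q}}{\partial x^{2l+q}}u_{p,h}(a)=\frac{\partial^{2l+q}}{\partial x^{2l+q}}u_{p,h}(b)=0\quad\text{for all }l\in\mathbb{N}_0\text{ with }2l+q<p.$$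
   Formalization: The inequality is stated for those u_{p,h} that lie in H^q(Ω); this is automatic for q ≤ p, but for q = p+1 a general spline is not in H^{p+1}(Ω) (its p-th derivative jumps), so |u_{p,h}|_{H^q} is undefined there. *)

(* Defs.v *)
From HB Require Import structures.
From mathcomp Require Import all_boot all_order all_algebra.
From mathcomp Require Import all_classical all_reals all_analysis.

Set Implicit Arguments.
Unset Strict Implicit.
Unset Printing Implicit Defensive.
Import Order.TTheory GRing.Theory Num.Theory.
Import numFieldNormedType.Exports.

Local Open Scope classical_set_scope.
Local Open Scope ring_scope.

Section splines.
Context {R : realType}.
Implicit Types (a b h : R) (p q r k : nat) (u v phi : R -> R).

Local Notation mu := (@lebesgue_measure R).

(* A function on (a, b) is represented by a function on R; functions on R are
   cut off by 0 outside (a, b), so that the library's L^2 notions apply. *)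

Definition L2 a b u := u \_ `]a, b[ \in Lfun mu 2%:E.

Definition L2norm a b u : \bar R := 'N[mu]_(2%:E)[EFin \o u \_ `]a, b[]%E.

(* C^oo functions with compact support contained in (a, b). *)
Definition test_function a b phi :=
  (forall k x, derivable (derive1n k phi) x 1) /\
  exists c d, [/\ a < c, d < b & forall x, phi x != 0 -> c <= x <= d].

Definition weak_derivative a b k u v :=
  forall phi, test_function a b phi ->
    \int[mu]_(x in `]a, b[) (u x * derive1n k phi x) =
    (-1) ^+ k * \int[mu]_(x in `]a, b[) (v x * phi x).

(* The Sobolev space H^r(a, b), with H^0 = L^2. *)
Definition sobolev a b r u :=
  L2 a b u /\
  forall k, (k <= r)%N -> exists2 v, L2 a b v & weak_derivative a b k u v.

(* A representative of the r-th weak derivative (unique almost everywhere)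
   of u; it is meaningful only for u in H^r(a, b). *)
Definition sobolev_derivative a b r u : R -> R :=
  xget (cst 0) [set v | L2 a b v /\ weak_derivative a b r u v].

Definition sobolev_seminorm a b r u : \bar R :=
  L2norm a b (sobolev_derivative a b r u).

Definition grid_size a b h :=
  0 < h /\ exists2 n : nat, (0 < n)%N & h^-1 * (b - a) = n%:R.

(* For a grid size h, j%:R < h^-1 * (b - a) = n_h says that j is one of
   0, ..., n_h - 1; degree at most p is size at most p + 1. *)
Definition spline a b h p u :=
  sobolev a b p u /\
  forall j : nat, j%:R < h^-1 * (b - a) ->
    exists2 P : {poly R}, (size P <= p.+1)%N &
      forall x, a + h * j%:R < x <= a + h * j.+1%:R -> u x = P.[x].

(* Since u is a polynomial near each endpoint of (a, b), the value of a
   derivative at an endpoint is the one-sided limit of the classical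
   derivative. *)
Definition spline_bc a b h q p u :=
  spline a b h p u /\
  forall l, (2 * l + q < p)%N ->
    derive1n (2 * l + q) u x @[x --> a^'+] --> (0 : R) /\
    derive1n (2 * l + q) u x @[x --> b^'-] --> (0 : R).

(* Splines of degree p have the regularity needed for the seminorms of order
   at most p. *)
Lemma spline_sobolev a b h p r u :
  (r <= p)%N -> spline a b h p u -> sobolev a b r u.
Proof.
move=> rp [[u2 up] _]; split=> // k kr; apply: up.
exact: leq_trans rp.
Qed.

End splines.

(* Main.v *)
Require Import Defs.
From HB Require Import structures.
From mathcomp Require Import all_boot all_order all_algebra.
From mathcomp Require Import all_classical all_reals all_analysis.
From mathcomp Require Import measurable_realfun.
From mathcomp Require Import ring lra.

(* Let E_k be the square of |u|_{H^k}. For q - 1 <= k <= p - 2 the functions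
   u^(k) and u^(k+1) are continuous, and the boundary conditions kill one of
   them at each endpoint, so integrating by parts
     E_{k+1} = - int u^(k) u^(k+2),
   and Cauchy-Schwarz gives E_{k+1}^2 <= E_k E_{k+2}. Hence the ratios
   E_{k+1} / E_k increase with k, up to E_p / E_{p-1}, which is at most
   12 / h^2 because u^(p-1) is affine on each cell. For q = p + 1 the left-hand
   side is zero.

   That the weak derivatives are the piecewise derivatives, and that those of
   order below p do not jump at the nodes, is seen by testing against products
   of two rescaled copies of exp(-1/x). *)

Set Implicit Arguments.
Unset Strict Implicit.
Unset Printing Implicit Defensive.
Import Order.TTheory GRing.Theory Num.Theory.
Import numFieldNormedType.Exports.

Local Open Scope classical_set_scope.
Local Open Scope ring_scope.

(** * Smooth cutoff functions *)

Section smooth_functions.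
Context {R : realType}.
Implicit Types (f g : R -> R) (P : {poly R}).

Definition smooth f := forall k x, derivable (derive1n k f) x 1.

(** The recursion takes the first derivative innermost, so the sum and product rules apply at the
    head and closure follows by induction on [k]; iterating [derive1n] from outside would require a
    general Leibniz formula. *)
Fixpoint kdiff k f : Prop :=
  if k is k'.+1 then (forall x, derivable f x 1) /\ kdiff k' (derive1 f)
  else True.

Lemma kdiffW k f : kdiff k.+1 f -> kdiff k f.
Proof. by elim: k f => //= k IH f [df /IH]. Qed.

Lemma smoothP f : smooth f <-> forall k, kdiff k f.
Proof.
split=> [sf k|kf k].
  elim: k f sf => //= k IH f sf; split; first exact: (sf 0%N).
  by apply: IH => i x; rewrite -derive1Sn; exact: sf.
elim: k f kf => [|k IH] f kf x; first by have [] := kf 1%N.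
by rewrite derive1Sn; apply: IH => j; have [] := kf j.+1.
Qed.

Lemma derive1_add f g :
  (forall x, derivable f x 1) -> (forall x, derivable g x 1) ->
  derive1 (f \+ g) = derive1 f \+ derive1 g.
Proof.
move=> df dg; apply/funext => x.
rewrite /= !derive1E.
exact: (deriveD (df x) (dg x)).
Qed.

Lemma derive1_mul f g :
  (forall x, derivable f x 1) -> (forall x, derivable g x 1) ->
  derive1 (f \* g) = (f \* derive1 g) \+ (g \* derive1 f).
Proof.
move=> df dg; apply/funext => x.
rewrite /= !derive1E.
exact: (deriveM (df x) (dg x)).
Qed.

Lemma kdiffD k f g : kdiff k f -> kdiff k g -> kdiff k (f \+ g).
Proof.
elim: k f g => //= k IH f g [df kf] [dg kg]; split.
  by move=> x; exact: (derivableD (df x) (dg x)).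
by rewrite (derive1_add df dg); exact: IH.
Qed.

Lemma kdiffM k f g : kdiff k f -> kdiff k g -> kdiff k (f \* g).
Proof.
elim: k f g => //= k IH f g [df kf] [dg kg]; split.
  by move=> x; exact: (derivableM (df x) (dg x)).
rewrite (derive1_mul df dg).
by apply: kdiffD; apply: IH => //; exact: (@kdiffW k).
Qed.

Lemma smoothM f g : smooth f -> smooth g -> smooth (f \* g).
Proof.
by move=> /smoothP sf /smoothP sg; apply/smoothP => k; apply: kdiffM.
Qed.

Lemma derive1_affine f (c d x : R) : derivable f (c * x + d) 1 ->
  derivable (fun x => f (c * x + d)) x 1 /\
  derive1 (fun x => f (c * x + d)) x = c * derive1 f (c * x + d).
Proof.
move=> /derivableP df.
have dg : is_derive x (1 : R) (fun x : R => c * x + d) c.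
  have -> : (fun x : R => c * x + d) = horner (c *: 'X + d%:P).
    by apply/funext => y; rewrite !hornerE.
  suff {2}-> : c = (c *: 'X + d%:P)^`().[x] by exact: is_derive_poly.
  by rewrite derivD derivZ derivX derivC !hornerE.
have [h1 h2] := @is_derive1_comp R f (fun x : R => c * x + d) x _ _ df dg.
split; first exact: h1.
by rewrite !derive1E mulrC; exact: h2.
Qed.

Lemma derive1_scale f (c x : R) : derivable f x 1 ->
  derivable (fun x => c * f x) x 1 /\
  derive1 (fun x => c * f x) x = c * derive1 f x.
Proof.
move=> df; split; first exact: (@derivableZ _ _ _ f c x 1 df).
by rewrite !derive1E; exact: (@deriveZ _ _ _ f c x 1 df).
Qed.

Lemma smooth_affine f (c d : R) : smooth f -> smooth (fun x => f (c * x + d)).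
Proof.
move=> sf k.
have H : derive1n k (fun x => f (c * x + d)) =
         fun x => c ^+ k * derive1n k f (c * x + d).
  elim: k => [|k IH]; first by apply/funext => x; rewrite expr0 mul1r.
  apply/funext => x; rewrite derive1nS IH.
  have [dx e] := derive1_affine (sf k (c * x + d)).
  by rewrite (derive1_scale _ dx).2 e mulrA -exprSr.
move=> x; rewrite H.
have [dx _] := derive1_affine (sf k (c * x + d)).
by have [] := derive1_scale (c ^+ k) dx.
Qed.

(** One term of the exponential series suffices for each monomial: y^(i+1) / (i+1)! <= exp y bounds
    y^i exp(-y) by (i+1)! / y. *)
Lemma horner_expRN_le P : exists2 C, 0 <= C &
  forall y, 0 < y -> `|P.[y] * expR (- y)| <= C * y^-1.
Proof.
exists (\sum_(i < size P) `|P`_i| * (i.+1)`!%:R).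
  by apply: sumr_ge0 => i _; apply: mulr_ge0.
move=> y y0; rewrite horner_coef !mulr_suml.
apply: le_trans (ler_norm_sum _ _ _) _; apply: ler_sum => i _.
rewrite !normrM -!mulrA; apply: ler_wpM2l => //.
rewrite (gtr0_norm (expR_gt0 _)) ger0_norm ?exprn_ge0 ?(ltW y0)//.
have {}H : y ^+ i.+1 / i.+1`!%:R <= expR y.
  by apply: le_trans (expR_ge1Dxn i (ltW y0)); rewrite lerDr.
rewrite expRN ler_pdivrMr ?expR_gt0// mulrAC ler_pdivlMr// -exprSr.
by rewrite mulrC -ler_pdivrMr// ltr0n fact_gt0.
Qed.

(* At P = 1 this is the usual flat function; letting P vary gives a family
   stable under differentiation. *)
Definition flat P (x : R) := if 0 < x then P.[x^-1] * expR (- x^-1) else 0.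

(** The bound for [P * 'X] at y = 1/x reads |P(y) y exp(-y)| <= C x; multiplying by x gives the
    square, which forces a zero derivative at 0. *)
Lemma flat_le P : exists C, forall x, `|flat P x| <= C * x ^+ 2.
Proof.
have [C C0 H] := horner_expRN_le (P * 'X); exists C => x.
rewrite /flat; case: ifPn => x0; last first.
  by rewrite normr0 mulr_ge0// sqr_ge0.
have xi : 0 < x^-1 by rewrite invr_gt0.
have := H _ xi; rewrite hornerM hornerX invrK !normrM (gtr0_norm xi) => H1.
have := ler_wpM2r (ltW x0) H1.
rewrite -[C * x * x]mulrA -expr2; apply: le_trans.
by rewrite [_ * x]mulrAC mulfVK ?gt_eqF.
Qed.

Lemma is_derive_quadratic_bound f C : (forall x, `|f x| <= C * x ^+ 2) ->
  is_derive (0 : R) (1 : R) f 0.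
Proof.
move=> H.
have f0 : f 0 = 0.
  apply/eqP; rewrite -normr_le0; apply: le_trans (H 0) _.
  by rewrite expr0n mulr0.
have C0 : 0 <= C by have := H 1; rewrite expr1n mulr1; apply: le_trans.
have L : h^-1 *: (f (h *: (1 : R) + 0) - f 0) @[h --> 0^'] --> (0 : R).
  apply/cvgrPdist_le => /= e e0.
  near=> x; rewrite f0 subr0 addr0 sub0r normrN normrZ /GRing.scale/= mulr1.
  have x0 : x != 0 by near: x; exact: nbhs_dnbhs_neq.
  rewrite normfV ler_pdivrMl ?normr_gt0//.
  apply: le_trans (H x) _; rewrite -real_normK ?num_real// expr2 mulrA.
  rewrite [leRHS]mulrC; apply: ler_wpM2r => //.
  (* [C] may be 0; [C + 1] keeps the radius [e / (C + 1)] meaningful. *)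
  apply: (@le_trans _ _ ((C + 1) * `|x|)); first by rewrite ler_wpM2r// lerDl.
  rewrite mulrC -ler_pdivlMr ?ltr_wpDl//.
  near: x; apply: nbhs_dnbhs; apply/nbhs_normP; exists (e / (C + 1)).
    by rewrite /= divr_gt0// ltr_wpDl.
  by move=> x /=; rewrite sub0r normrN => /ltW.
apply: DeriveDef; first by apply/cvg_ex; exists 0.
exact: (cvg_lim (@Rhausdorff R)).
Unshelve. all: by end_near. Qed.

(** For x > 0 the chain rule through 1/x gives x^-2 (P - P')(1/x) exp(-1/x), hence the factor
    ['X^2]. For x < 0 the function is locally 0, and at 0 the quadratic bound applies. *)
Lemma is_derive_flat P (x : R) :
  is_derive x (1 : R) (flat P) (flat ('X^2 * (P - P^`())) x).
Proof.
have [x0|x0|->] := ltgtP x 0.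
- rewrite {2}/flat ltNge (ltW x0)/=.
  apply: (@near_eq_is_derive _ _ _ (cst 0)).
    near=> y; suff y0 : y < 0 by rewrite /flat ltNge (ltW y0).
    by near: y; exact: lt_nbhsl.
- have x0' : x != 0 by rewrite gt_eqF.
  have dV : is_derive x (1 : R) (fun y : R => y^-1) (- x ^- 2).
    have := @is_deriveV _ id x 1 1 x0' (is_derive_id _ _).
    by rewrite /GRing.scale/= mulr1.
  have dP : is_derive x (1 : R) (fun y => P.[y^-1]) (P^`().[x^-1] * - x ^- 2).
    exact: (@is_derive1_comp _ (horner P) (fun y : R => y^-1) _ _ _
      (is_derive_poly _ _) dV).
  have dN : is_derive x (1 : R) (fun y : R => - y^-1) (x ^- 2).
    by rewrite -[x ^- 2]opprK; exact: is_deriveN dV.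
  have dE := @is_derive1_comp _ expR (fun y : R => - y^-1) _ _ _
    (is_derive_expR _) dN.
  have dF := is_deriveM dP dE.
  have -> : flat ('X^2 * (P - P^`())) x =
      P.[x^-1] *: (expR (- x^-1) *: x ^- 2) +
      expR (- x^-1) *: (P^`().[x^-1] * - x ^- 2).
    rewrite /flat x0 /GRing.scale/= hornerM hornerXn hornerD hornerN exprVn.
    by ring.
  refine (@near_eq_is_derive _ _ _ _ _ _ _ _ _ dF); near=> y.
  suff y0 : 0 < y by rewrite /flat y0.
  by near: y; exact: lt_nbhsr.
- rewrite {2}/flat ltxx; have [C H] := flat_le P.
  exact: is_derive_quadratic_bound H.
Unshelve. all: by end_near. Qed.

Lemma smooth_flat P : smooth (flat P).
Proof.
apply/smoothP => k; elim: k P => //= k IH P; split.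
  by move=> x; have [] := is_derive_flat P x.
rewrite (_ : derive1 (flat P) = flat ('X^2 * (P - P^`())))//.
by apply/funext => x; rewrite derive1E; have [] := is_derive_flat P x.
Qed.

Lemma flat1_ge0 (x : R) : 0 <= flat 1 x.
Proof. by rewrite /flat; case: ifP => // _; rewrite hornerC mul1r expR_ge0. Qed.

Lemma flat1_le1 (x : R) : flat 1 x <= 1.
Proof.
rewrite /flat; case: ifP => // x0.
by rewrite hornerC mul1r expR_le1 oppr_le0 invr_ge0 ltW.
Qed.

Lemma flat1_gt0 (x : R) : (0 < flat 1 x) = (0 < x).
Proof. by rewrite /flat; case: ifP; rewrite ?ltxx// hornerC mul1r expR_gt0. Qed.

Lemma flat1_cvg1 (y : nat -> R) : y n @[n --> \oo] --> +oo ->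
  flat 1 (y n) @[n --> \oo] --> (1 : R).
Proof.
move=> yoo.
have y0 : \forall n \near \oo, 0 < y n by move/cvgryPgt: yoo; apply.
apply: (@cvg_trans _ (expR (- (y n)^-1) @[n --> \oo])).
  apply: near_eq_cvg; near=> n; rewrite /flat.
  have -> : 0 < y n by near: n.
  by rewrite hornerC mul1r.
rewrite -expR0 -oppr0; apply: continuous_cvg; first exact: continuous_expR.
by apply: cvgN; apply/gtr0_cvgV0.
Unshelve. all: by end_near. Qed.

(* The arguments of flat 1 are r (x - s) - 1 and r (t - x) - 1. The shifts by 1
   keep the support inside [s + 1/r, t - 1/r], so that this is a test function
   on (a, b) even when s = a or t = b. *)
Definition cutoff (r s t x : R) :=
  flat 1 (r * x + (- (r * s) - 1)) * flat 1 (- r * x + (r * t - 1)).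

Lemma smooth_cutoff r s t : smooth (cutoff r s t).
Proof.
by apply: smoothM; apply: smooth_affine; exact: smooth_flat.
Qed.

Lemma cutoff_gt0 r s t x :
  (0 < cutoff r s t x) = (1 < r * (x - s)) && (1 < r * (t - x)).
Proof.
rewrite /cutoff.
have -> : r * x + (- (r * s) - 1) = r * (x - s) - 1 by ring.
have -> : - r * x + (r * t - 1) = r * (t - x) - 1 by ring.
rewrite -(subr_gt0 1 (r * (x - s))) -(subr_gt0 1 (r * (t - x))).
rewrite -(flat1_gt0 (_ * (x - s) - 1)) -(flat1_gt0 (_ * (t - x) - 1)).
by rewrite !lt0r mulf_eq0 negb_or mulr_ge0 ?flat1_ge0// !andbT.
Qed.

Lemma cutoff_ge0 r s t x : 0 <= cutoff r s t x.
Proof. by rewrite mulr_ge0// flat1_ge0. Qed.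

Lemma cutoff_neq0 r s t x : 0 < r -> cutoff r s t x != 0 ->
  s + r^-1 <= x <= t - r^-1.
Proof.
move=> r0 b0; have : 0 < cutoff r s t x by rewrite lt0r b0 cutoff_ge0.
rewrite cutoff_gt0 -!ltr_pdivrMl// mulr1 => /andP[/ltW h1 /ltW h2].
by apply/andP; split; lra.
Qed.

Lemma cutoff_le1 r s t x : `|cutoff r s t x| <= 1.
Proof.
by rewrite ger0_norm ?cutoff_ge0// mulr_ile1 ?flat1_ge0 ?flat1_le1.
Qed.

Lemma cutoff_cvg s t x :
  cutoff n%:R s t x @[n --> \oo] --> (\1_(`]s, t[) x : R).
Proof.
have noo (y : R) : 0 < y -> n%:R * y - 1 @[n --> \oo] --> +oo.
  move=> y0; apply/cvgryPge => A; near=> n.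
  rewrite lerBrDr -ler_pdivrMr//.
  by near: n; exact: nbhs_infty_ger.
rewrite indicE; have [/set_mem/=|] := boolP (x \in _).
  rewrite in_itv/= => /andP[sx xt].
  rewrite -[X in _ --> X]mulr1; apply: cvgM; apply: flat1_cvg1.
    have := noo _ (_ : 0 < x - s); rewrite subr_gt0 => /(_ sx).
    by under eq_fun do rewrite mulrBr -addrA.
  have := noo _ (_ : 0 < t - x); rewrite subr_gt0 => /(_ xt).
  by under eq_fun do rewrite mulrBr [_ - _ * x]addrC -mulNr -addrA.
move/negP; rewrite inE/= in_itv/= => xst.
apply: cvg_near_cst; apply: nearW => n; apply/eqP; apply: contra_notT xst => b0.
have : 0 < cutoff n%:R s t x by rewrite lt0r b0 cutoff_ge0.
(* Scale 0 is treated apart because the next line divides by [n]; both arguments of [flat 1] are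
   then -1. *)
have [->|n0] := posnP n; first by rewrite cutoff_gt0 !mul0r ltr10.
rewrite cutoff_gt0 -!ltr_pdivrMl ?ltr0n// mulr1.
rewrite -[s < x]subr_gt0 -[x < t]subr_gt0.
move=> /andP[h1 h2].
by rewrite (lt_trans _ h1) ?(lt_trans _ h2)// invr_gt0 ltr0n.
Unshelve. all: by end_near. Qed.

Lemma test_function_cutoff a b r s t : a <= s -> t <= b -> 0 < r ->
  test_function a b (cutoff r s t).
Proof.
move=> sa tb r0; split; first exact: smooth_cutoff.
exists (s + r^-1), (t - r^-1); split.
- by rewrite ltr_pwDr// invr_gt0.
- by rewrite ltrBlDr ltr_pwDr// invr_gt0.
- by move=> x; exact: cutoff_neq0.
Qed.

End smooth_functions.

(** * Integrals of polynomials against smooth functions *)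

Section integrals.
Context {R : realType}.
Implicit Types (f g phi u v : R -> R) (P : {poly R}) (a b s t : R).
Local Notation mu := (@lebesgue_measure R).

Lemma smooth_continuous phi k : smooth phi -> continuous (derive1n k phi).
Proof.
by move=> sphi x; apply/differentiable_continuous/derivable1_diffP; exact: sphi.
Qed.

Lemma continuous_integrable_cc f s t : continuous f ->
  mu.-integrable `[s, t] (EFin \o f).
Proof.
move=> cf; apply: continuous_compact_integrable; first exact: segment_compact.
exact: continuous_subspaceT.
Qed.

Lemma continuous_integrable_oo f s t : continuous f ->
  mu.-integrable `]s, t[ (EFin \o f).
Proof.
move=> cf; apply: integrableS (continuous_integrable_cc s t cf) => //.
exact: subset_itv_oo_cc.
Qed.

(** Weak derivatives are tested on open intervals, while integration by parts is applied on closed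
    ones. *)
Lemma continuous_Rintegral_oo_cc f s t : continuous f ->
  \int[mu]_(x in `]s, t[) f x = \int[mu]_(x in `[s, t]) f x.
Proof.
move=> cf; rewrite Rintegral_itv_bndo_bndc; last first.
  exact: continuous_integrable_oo.
rewrite Rintegral_itv_obnd_cbnd//.
apply: integrableS (continuous_integrable_cc s t cf) => //.
exact: subset_itv_oc_cc.
Qed.

Lemma continuousM_fun f g : continuous f -> continuous g ->
  continuous (fun x => f x * g x).
Proof. by move=> cf cg x; apply: cvgM; [exact: cf|exact: cg]. Qed.

Lemma derivable_oo_LRcontinuousT f s t : (forall x, derivable f x 1) ->
  derivable_oo_LRcontinuous f s t.
Proof.
move=> df; have cf : continuous f.
  by move=> x; apply/differentiable_continuous/derivable1_diffP; exact: df.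
by split => //; [exact/cvg_at_right_filter/cf|exact/cvg_at_left_filter/cf].
Qed.

Lemma Rintegration_by_parts_horner P phi s t : s < t ->
  (forall x, derivable phi x 1) -> continuous (derive1 phi) ->
  \int[mu]_(x in `]s, t[) (P.[x] * derive1 phi x) =
  P.[t] * phi t - P.[s] * phi s - \int[mu]_(x in `]s, t[) (P^`().[x] * phi x).
Proof.
move=> st dphi cphi'.
have cphi : continuous phi.
  by move=> x; apply/differentiable_continuous/derivable1_diffP.
rewrite !continuous_Rintegral_oo_cc; last 2 first.
- by apply: continuousM_fun => //; exact: continuous_horner.
- by apply: continuousM_fun => //; exact: continuous_horner.
apply: (@Rintegration_by_parts _ (horner P) phi (horner P^`()) (derive1 phi)).
- exact: st.
- by apply: continuous_subspaceT; exact: continuous_horner.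
- by apply: (@derivable_oo_LRcontinuousT (horner P)); exact: derivable_horner.
- by move=> x _; rewrite derivE.
- exact: continuous_subspaceT.
- exact: derivable_oo_LRcontinuousT.
- by move=> x _.
Qed.

(* The endpoint term of k integrations by parts: the sum over i < k of
   (-1)^i P^(i)(x) phi^(k-1-i)(x). *)
Fixpoint boundary k P phi x : R :=
  if k is k'.+1 then P.[x] * derive1n k' phi x - boundary k' P^`() phi x else 0.

Lemma boundaryS k P phi x : boundary k.+1 P phi x =
  P.[x] * derive1n k phi x - boundary k P^`() phi x.
Proof. by []. Qed.

Lemma Rintegral_horner_derive1n k P phi s t : s < t -> smooth phi ->
  \int[mu]_(x in `]s, t[) (P.[x] * derive1n k phi x) =
  boundary k P phi t - boundary k P phi s +
  (-1) ^+ k * \int[mu]_(x in `]s, t[) (P^`(k).[x] * phi x).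
Proof.
move=> st sphi; elim: k P => [|k IH] P.
  by rewrite subrr expr0 mul1r add0r.
have := @Rintegration_by_parts_horner P (derive1n k phi) s t st (sphi k)
  (smooth_continuous (k := k.+1) sphi).
by rewrite derive1nS => ->; rewrite IH derivSn exprS !boundaryS; ring.
Qed.

Lemma boundary_eq0 k P phi x : (forall i, derive1n i phi x = 0) ->
  boundary k P phi x = 0.
Proof. by move=> H; elim: k P => //= k IH P; rewrite H IH mulr0 subr0. Qed.

Lemma boundaryB k P Q phi x :
  boundary k (P - Q) phi x = boundary k P phi x - boundary k Q phi x.
Proof.
elim: k P Q => [|k IH] P Q /=; first by rewrite subr0.
by rewrite derivB IH hornerD hornerN; ring.
Qed.

(** Only the summand of index [k] survives, the one without a derivative of [phi]. For the
    difference of two neighbouring pieces it isolates the first jump that is not yet known to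
    vanish. *)
Lemma boundary_low k P phi x : (forall i, (i < k)%N -> P^`(i).[x] = 0) ->
  boundary k.+1 P phi x = (-1) ^+ k * P^`(k).[x] * phi x.
Proof.
elim: k P => [|k IH] P H /=; first by rewrite subr0 expr0 mul1r.
have := H 0%N isT; rewrite derivn0 => ->; rewrite mul0r sub0r.
have := IH P^`(); rewrite /= -derivSn => ->; first by rewrite exprS; ring.
by move=> i ik; rewrite -derivSn; apply: H.
Qed.

(** The complement of [[c, d]] is open, so a function that is 0 there is 0 near each of its points,
    and so is the derivative. *)
Lemma derive1n_support phi c d k x :
  (forall x, phi x != 0 -> c <= x <= d) -> derive1n k phi x != 0 -> c <= x <= d.
Proof.
elim: k x => [|k IH] x H; first exact: H.
apply: contraTT => xcd; rewrite negbK derive1nS derive1E.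
have H0 : \forall y \near x, derive1n k phi y = cst 0 y.
  have : (~` `[c, d]%classic) x by rewrite /= in_itv/=; exact/negP.
  have : open (~` `[c, d]%classic : set R) by exact/closed_openC/itv_closed.
  rewrite openE => /[apply]; rewrite /interior.
  apply: filterS => y /= /negP; rewrite in_itv/= => ycd.
  by apply/eqP; apply: contraNT ycd; exact: IH.
by rewrite (near_eq_derive _ H0) derive_cst.
Qed.

Lemma Rintegral_cells f a h m : 0 < h ->
  mu.-integrable `]a, a + h * m%:R[ (EFin \o f) ->
  \int[mu]_(x in `]a, a + h * m%:R[) f x =
  \sum_(j < m) \int[mu]_(x in `]a + h * j%:R, a + h * j.+1%:R[) f x.
Proof.
move=> h0; elim: m => [|m IH] intf.
  by rewrite mulr0 addr0 big_ord0 set_itvoo0 ?Rintegral_set0.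
have mm : a + h * m%:R < a + h * m.+1%:R.
  by rewrite ltrD2l ltr_pM2l// ltr_nat.
have intm : mu.-integrable `]a, a + h * m%:R[ (EFin \o f).
  apply: integrableS intf => //.
  by apply: subset_itvl; rewrite bnd_simp ltW.
rewrite big_ord_recr/= -IH//.
rewrite -(@Rintegral_itvB _ f _ _ (a + h * m%:R) intf); last 2 first.
- by rewrite bnd_simp lerDl mulr_ge0// ltW.
- by rewrite bnd_simp.
by rewrite (Rintegral_itv_bndo_bndc intm) addrC subrK.
Qed.

End integrals.

(** * The fundamental lemma of the calculus of variations *)

Section L2functions.
Context {R : realType}.
Implicit Types (f g phi u v : R -> R) (P : {poly R}) (a b s t : R).
Local Notation mu := (@lebesgue_measure R).

Lemma L2_integrable_sqr a b u : L2 a b u ->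
  mu.-integrable `]a, b[ (EFin \o (fun x => u x ^+ 2)).
Proof.
move=> /Lfun2_integrable_sqr iu.
have {}iu : mu.-integrable `]a, b[ (EFin \o (fun x => (u \_ `]a, b[) x ^+ 2)).
  exact: integrableS iu.
apply: eq_integrable iu => // x xab.
by rewrite /= patchE xab.
Qed.

Lemma L2_measurable a b u : L2 a b u -> measurable_fun `]a, b[ u.
Proof.
rewrite /L2 inE => /andP[/[!inE]/= mu1 _].
by apply/(measurable_restrictT _ _).2 => //.
Qed.

(** The interval is bounded and |u| <= 1 + u^2, by expanding (|u| - 1)^2 >= 0. *)
Lemma L2_integrable a b u : L2 a b u -> mu.-integrable `]a, b[ (EFin \o u).
Proof.
move=> u2; have iu := L2_integrable_sqr u2.
have i1 : mu.-integrable `]a, b[ (EFin \o (fun x => 1 + u x ^+ 2)).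
  have c1 : mu.-integrable `]a, b[ (EFin \o (fun=> (1 : R))).
    by apply: continuous_integrable_oo => x; exact: cvg_cst.
  by have := integrableD _ c1 iu; apply.
apply: le_integrable i1 => //.
  by apply/measurable_EFinP; exact: L2_measurable.
move=> x _; rewrite /= lee_fin [leRHS]ger0_norm ?addr_ge0 ?sqr_ge0//.
have := sqr_ge0 (`|u x| - 1); rewrite sqrrB expr1n mulr1 real_normK ?num_real//.
have := normr_ge0 (u x); have := sqr_ge0 (u x); lra.
Qed.

Lemma integrable_mul_continuous s t f phi :
  mu.-integrable `]s, t[ (EFin \o f) -> continuous phi ->
  mu.-integrable `]s, t[ (EFin \o (fun x => f x * phi x)).
Proof.
move=> fi cphi; have := @integrableMl _ _ R mu _ _ (EFin \o f) phi fi.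
apply => //.
  by apply: measurable_funTS; exact: continuous_measurable_fun.
have cK := continuous_compact (continuous_subspaceT (A := `[s, t]) cphi)
  (@segment_compact _ s t).
have [M [Mr H]] := compact_bounded cK.
exists M; split => // x Mx y /= yst; apply: (H x Mx).
by exists y => //; apply: subset_itv_oo_cc.
Qed.

Lemma integrable_patch c d f : mu.-integrable `]c, d[ (EFin \o f) ->
  mu.-integrable setT (EFin \o (f \_ `]c, d[)).
Proof.
move=> fi; have : mu.-integrable setT ((EFin \o f) \_ `]c, d[).
  by apply/(integrable_mkcond _ _).1.
by rewrite restrict_EFin.
Qed.

(** The cutoffs are bounded by 1 and tend to the indicator of []c, t[], so by dominated convergence
    the primitive of [f] from [c] vanishes on []c, d[]. Lebesgue differentiation then recovers [f]
    almost everywhere. *)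
Lemma ae_eq0_of_cutoff c d f : mu.-integrable `]c, d[ (EFin \o f) ->
  (forall n t, c < t < d ->
    \int[mu]_(x in `]c, d[) (f x * cutoff n.+1%:R c t x) = 0) ->
  {ae mu, forall x, `]c, d[%classic x -> f x = 0}.
Proof.
move=> fi H.
have H0 t : c < t < d -> \int[mu]_(x in `]c, t[) f x = 0.
  move=> /andP[ct td].
  have bc n : continuous (cutoff n.+1%:R c t) :=
    @smooth_continuous R _ 0 (@smooth_cutoff R _ _ _).
  have ib n := integrable_mul_continuous fi (bc n).
  have := @dominated_convergence _ _ R mu `]c, d[ (measurable_itv _)
    (fun n x => (f x * cutoff n.+1%:R c t x)%:E)
    (fun x => (f x * \1_(`]c, t[) x)%:E)
    (fun x => `|f x|%:E).
  case.
  - by move=> n; exact: measurable_int (ib n).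
  - apply/measurable_EFinP/measurable_funM.
      by apply/measurable_EFinP; exact: measurable_int fi.
    exact: measurable_indic.
  - apply: aeW => x _; apply: cvg_EFin; first by apply: nearW.
    apply: cvgM; first exact: cvg_cst.
    by have := @cutoff_cvg R c t x; rewrite -cvg_shiftS.
  - exact: integrable_norm fi.
  - apply: aeW => x n _; rewrite /= lee_fin normrM -[leRHS]mulr1.
    by rewrite ler_wpM2l// cutoff_le1.
  - move=> _ _; set S := (X in X @ \oo --> _) => Scvg.
    have S0 : S = fun=> 0%E.
      apply/funext => n; rewrite /S /=.
      have ctd : c < t < d by rewrite ct td.
      have := congr1 EFin (H n t ctd).
      by rewrite /Rintegral fineK//; exact: integrable_fin_num (ib n).
    rewrite S0 in Scvg.
    have E := congr1 fine (cvg_unique (@ereal_hausdorff R) Scvg (cvg_cst _)).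
    have <- : `]c, d[ `&` `]c, t[ = `]c, t[%classic :> set R.
      by apply: setIidr; apply: subset_itvl; rewrite bnd_simp ltW.
    rewrite Rintegral_mkcondr -[RHS]E; apply: eq_Rintegral => x _.
    by rewrite patchE indicE; case: ifPn; rewrite ?mulr1 ?mulr0.
pose g := f \_ `]c, d[.
have gi := integrable_patch fi.
have := @FTC1 R g (BRight c) _ (open_integrable_locally openT gi).
case; first by move=> y; exact: integrableS gi.
move=> A [mA A0 HA]; exists A; split => //; apply: subset_trans HA => x /= Hx.
apply: contra_not Hx => Hx; rewrite in_itv/= => /andP[cx xd].
have [//|_] := Hx.
rewrite /g patchE mem_set /= ?in_itv/= ?cx// => <-.
(* Near a point of []c, d[] the primitive is 0 by [H0], hence so is its derivative. *)
rewrite derive1E.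
rewrite (@near_eq_derive _ _ _ _ (cst 0)) ?derive_cst//.
near=> y.
have cy : c < y by near: y; exact: lt_nbhsr.
have yd : y < d by near: y; exact: lt_nbhsl.
rewrite -[RHS](H0 y) ?cy// Rintegral_itv_bndo_bndc; last first.
  by apply: integrableS fi => //; apply: subset_itvl; rewrite bnd_simp ltW.
apply: eq_Rintegral => z; rewrite inE/= in_itv/= => /andP[cz zy].
by rewrite patchE mem_set//= in_itv/= cz (le_lt_trans zy).
Unshelve. all: by end_near. Qed.

End L2functions.

(** * Weak derivatives of piecewise polynomials *)

Section piecewise.
Context {R : realType}.
Implicit Types (f g phi u v : R -> R) (a b c d s t h : R).
Local Notation mu := (@lebesgue_measure R).

Lemma Rintegral_subset_support (A B : set R) f :
  A `<=` B -> (forall x, B x -> ~ A x -> f x = 0) ->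
  \int[mu]_(x in B) f x = \int[mu]_(x in A) f x.
Proof.
move=> AB f0; rewrite -[in RHS](setIidr AB) Rintegral_mkcondr.
apply: eq_Rintegral => x; rewrite inE patchE => Bx.
case: ifPn => // /negP; rewrite inE.
exact: f0.
Qed.

Lemma ae_imply (Q1 Q2 : R -> Prop) : (forall x, Q1 x -> Q2 x) ->
  {ae mu, forall x, Q1 x} -> {ae mu, forall x, Q2 x}.
Proof.
move=> Q12; apply: filterS; first exact: (ae_filter_ringOfSetsType mu).
exact: Q12.
Qed.

Lemma ae_eq_Rintegral (A : set R) f g : measurable A ->
  measurable_fun A f -> measurable_fun A g ->
  {ae mu, forall x, A x -> f x = g x} ->
  \int[mu]_(x in A) f x = \int[mu]_(x in A) g x.
Proof.
move=> mA mf mg fg; congr fine; apply: ae_eq_integral => //.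
- exact/measurable_EFinP.
- exact/measurable_EFinP.
- by apply: ae_imply fg => x fg Ax; rewrite /= fg.
Qed.

Lemma horner_mul_continuous (P : {poly R}) phi k : smooth phi ->
  continuous (fun x => P.[x] * derive1n k phi x).
Proof.
move=> sphi; apply: continuousM_fun; first exact: continuous_horner.
exact: smooth_continuous.
Qed.

Variables (a h : R) (n : nat) (u : R -> R) (P : nat -> {poly R}).
Local Notation node j := (a + h * j%:R).
Local Notation b := (node n).
Local Notation cell j := (`]node j, node j.+1[%classic : set R).
Hypothesis h0 : 0 < h.
Hypothesis u2 : L2 a b u.
Hypothesis uP : forall j, (j < n)%N ->
  forall x, node j < x <= node j.+1 -> u x = (P j).[x].

Lemma node_le i j : (i <= j)%N -> node i <= node j.
Proof. by move=> ij; rewrite lerD2l ler_pM2l// ler_nat. Qed.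

Lemma node_lt i j : (i < j)%N -> node i < node j.
Proof. by move=> ij; rewrite ltrD2l ltr_pM2l// ltr_nat. Qed.

Lemma left_le_node j : a <= node j.
Proof. by rewrite lerDl mulr_ge0// ltW. Qed.

Lemma subset_nodes i j : (j <= n)%N -> `]node i, node j[ `<=` `]a, b[.
Proof.
move=> jn; apply: subset_itv; rewrite bnd_simp; first exact: left_le_node.
exact: node_le.
Qed.

Lemma spline_cell_integral j k phi : (j < n)%N ->
  \int[mu]_(x in cell j) (u x * derive1n k phi x) =
  \int[mu]_(x in cell j) ((P j).[x] * derive1n k phi x).
Proof.
move=> jn; apply: eq_Rintegral => x; rewrite inE/= in_itv/= => /andP[jx xj].
by rewrite (uP jn)// jx ltW.
Qed.

(** Test against cutoffs supported inside one cell: all endpoint terms vanish in [k] integrations by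
    parts, so [v] minus the classical derivative of the piece integrates to 0 against each of
    them. *)
Lemma weak_derivative_cell k v j : L2 a b v -> weak_derivative a b k u v ->
  (j < n)%N -> {ae mu, forall x, cell j x -> v x = (P j)^`(k).[x]}.
Proof.
move=> v2 wv jn.
have vi : mu.-integrable (cell j) (EFin \o v).
  by apply: integrableS (L2_integrable v2) => //; exact: subset_nodes.
have Pi : mu.-integrable (cell j) (EFin \o horner (P j)^`(k)).
  by apply: continuous_integrable_oo; exact: continuous_horner.
have fi : mu.-integrable (cell j) (EFin \o (fun x => v x - (P j)^`(k).[x])).
  by have := integrableB _ vi Pi; apply.
suff : {ae mu, forall x, cell j x -> v x - (P j)^`(k).[x] = 0}.
  by apply: ae_imply => x H jx; apply/eqP; rewrite -subr_eq0 H.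
apply: (ae_eq0_of_cutoff fi) => m t /andP[jt tj].
set phi := cutoff _ _ _.
have sphi : smooth phi := @smooth_cutoff R _ _ _.
have tphi : test_function a b phi.
  apply: test_function_cutoff; rewrite ?ltr0n ?left_le_node//.
  by apply: le_trans (node_le jn); exact: ltW.
have supp i x : derive1n i phi x != 0 -> node j < x < node j.+1.
  have mR : 0 < (m.+1%:R : R) by rewrite ltr0n.
  move=> /(derive1n_support (fun x => cutoff_neq0 mR)) /andP[h1 h2].
  have m0 : 0 < (m.+1%:R : R)^-1 by rewrite invr_gt0.
  apply/andP; split; first by apply: lt_le_trans h1; rewrite ltrDl.
  by apply: le_lt_trans h2 _; rewrite ltrBlDr (lt_trans tj)// ltrDl.
have red i g : \int[mu]_(x in `]a, b[) (g x * derive1n i phi x) =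
    \int[mu]_(x in cell j) (g x * derive1n i phi x).
  apply: Rintegral_subset_support; first exact: subset_nodes.
  move=> x _ /= /negP; rewrite in_itv/= => xj.
  have -> : derive1n i phi x = 0 by apply/eqP; apply: contraNT xj; exact: supp.
  by rewrite mulr0.
have d0 i x : (x <= node j) || (node j.+1 <= x) -> derive1n i phi x = 0.
  move=> H; apply/eqP; apply: contraLR H => /supp /andP[h1 h2].
  by rewrite negb_or -!ltNge h1.
have := wv _ tphi; rewrite red (red 0%N v) spline_cell_integral//.
rewrite Rintegral_horner_derive1n ?node_lt// !boundary_eq0; last 2 first.
- by move=> i; rewrite d0// lexx.
- by move=> i; rewrite d0// lexx orbT.
rewrite subrr add0r => /(mulfI _) E.
under eq_Rintegral do rewrite mulrBl.
have cphi := @smooth_continuous R phi 0 sphi.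
rewrite RintegralB//.
- by rewrite E ?subrr// signr_eq0.
- exact: integrable_mul_continuous.
- exact: (integrable_mul_continuous Pi).
Qed.

(** Test the weak derivative of order i + 1 against a cutoff supported in the two cells around the
    node. Cell by cell it is the classical derivative, so the integrals cancel and only endpoint
    terms at the common node remain. Lower jumps vanish by strong induction, which leaves the jump
    of order i times a positive number. *)
Lemma spline_jump k j : (j.+1 < n)%N ->
  (forall i, (0 < i <= k)%N ->
    exists2 v, L2 a b v & weak_derivative a b i u v) ->
  forall i, (i < k)%N -> (P j)^`(i).[node j.+1] = (P j.+1)^`(i).[node j.+1].
Proof.
move=> jn wd; elim/ltn_ind => i IH ik.
have [v v2 wv] := wd i.+1 ik.
(* The scale must exceed 1 / h for the cutoff to be positive at the middle node, at distance [h]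
   from both ends; with 2 / h both arguments of [flat 1] equal 1 there. *)
pose r := 2 / h; pose phi := cutoff r (node j) (node j.+2).
have r0 : 0 < r by rewrite divr_gt0.
have jj : node j.+1 = node j + h by rewrite -natr1; ring.
have jjj : node j.+2 = node j + h *+ 2 by rewrite -!natr1; ring.
have sphi : smooth phi := @smooth_cutoff R _ _ _.
have tphi : test_function a b phi.
  by apply: test_function_cutoff; rewrite ?left_le_node ?node_le.
have rV : 0 < r^-1 by rewrite invr_gt0.
have supp l x : derive1n l phi x != 0 -> node j < x < node j.+2.
  move=> /(derive1n_support (fun x => cutoff_neq0 r0)) /andP[h1 h2].
  apply/andP; split; first by apply: lt_le_trans h1; rewrite ltrDl.
  by apply: le_lt_trans h2 _; rewrite ltrBlDr ltrDl.
have red l g : mu.-integrable `]a, b[ (EFin \o g) ->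
    \int[mu]_(x in `]a, b[) (g x * derive1n l phi x) =
    \int[mu]_(x in cell j) (g x * derive1n l phi x) +
    \int[mu]_(x in cell j.+1) (g x * derive1n l phi x).
  move=> gi; rewrite (@Rintegral_subset_support `]node j, node j.+2[).
  - have E2 : node j.+2 = node j + h * 2%:R by rewrite jjj (mulr_natr h 2).
    rewrite {1}E2 Rintegral_cells//.
      by rewrite !big_ord_recl big_ord0 addr0 /= !mulr0 !mulr1 addr0 -E2 -jj.
    rewrite -E2.
    apply: integrable_mul_continuous; last exact: smooth_continuous.
    by apply: integrableS gi => //; exact: subset_nodes.
  - exact: subset_nodes.
  - move=> x _ /= /negP; rewrite in_itv/= => xj.
    have -> : derive1n l phi x = 0.
      by apply/eqP; apply: contraNT xj; exact: supp.
    by rewrite mulr0.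
have d0 l x : (x <= node j) || (node j.+2 <= x) -> derive1n l phi x = 0.
  move=> H; apply/eqP; apply: contraLR H => /supp /andP[h1 h2].
  by rewrite negb_or -!ltNge h1.
have vcell l : (l < n)%N -> \int[mu]_(x in cell l) (v x * derive1n 0 phi x) =
    \int[mu]_(x in cell l) ((P l)^`(i.+1).[x] * phi x).
  move=> ln.
  have mphi : measurable_fun (cell l) phi.
    apply: measurable_funTS; apply: continuous_measurable_fun.
    exact: (@smooth_continuous R phi 0).
  apply: ae_eq_Rintegral => //.
  - apply: measurable_funM => //.
    by apply: measurable_funS (L2_measurable v2) => //; exact: subset_nodes.
  - apply: measurable_funM => //.
    apply: measurable_funTS; apply: continuous_measurable_fun.
    exact: continuous_horner.
  - by apply: ae_imply (weak_derivative_cell v2 wv ln) => x H /H ->.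
have jn' : (j < n)%N by exact: ltnW.
have := wv _ tphi; rewrite red ?(red 0%N v)//; last 2 first.
- exact: L2_integrable.
- exact: L2_integrable.
rewrite !spline_cell_integral// !vcell// !Rintegral_horner_derive1n ?node_lt//.
rewrite (@boundary_eq0 _ _ (P j) _ (node j)); last first.
  by move=> l; rewrite d0// lexx.
rewrite (@boundary_eq0 _ _ (P j.+1) _ (node j.+2)); last first.
  by move=> l; rewrite d0// lexx orbT.
move=> E.
(* The same signed cell integrals stand on both sides of [E]; cancelling them leaves the endpoint
   terms from the left and from the right of the node. *)
have {}E : boundary i.+1 (P j - P j.+1) phi (node j.+1) = 0.
  rewrite boundaryB; move: E.
  move: (boundary _ (P j) _ _) (boundary _ (P j.+1) _ _) => A B.
  move: ((-1) ^+ i.+1) (\int[mu]_(x in cell j) _) => s I1.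
  move: (\int[mu]_(x in _) _) => I2 E.
  by rewrite -[RHS](subrr (s * (I1 + I2))) -{1}E; ring.
have phi0 : phi (node j.+1) != 0.
  rewrite gt_eqF// cutoff_gt0 jj jjj addrAC subrr add0r.
  have -> : node j + h *+ 2 - (node j + h) = h by ring.
  by rewrite /r divfK ?gt_eqF// ltr1n.
move: E; rewrite boundary_low.
  move/eqP; rewrite mulf_eq0 (negbTE phi0) orbF mulf_eq0 signr_eq0/=.
  rewrite derivnB hornerD hornerN subr_eq0.
  by move/eqP.
by move=> l li; rewrite derivnB hornerD hornerN IH ?subrr// (ltn_trans li).
Qed.

End piecewise.

(** * Energies of piecewise polynomials *)

Section energy.
Context {R : realType}.
Implicit Types (a b c d s t h : R) (F G Q : {poly R}).
Local Notation mu := (@lebesgue_measure R).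

Definition pint s t Q := \int[mu]_(x in `]s, t[) Q.[x].

(** This is integration by parts against the constant polynomial 1. *)
Lemma pint_deriv s t F : s < t -> pint s t F^`() = F.[t] - F.[s].
Proof.
move=> st; have := @Rintegration_by_parts_horner R 1 (horner F) s t st.
rewrite -derivE derivC.
rewrite !hornerC !mul1r => H.
have {}H := H (@derivable_horner _ F) (@continuous_horner _ F^`()).
transitivity (\int[mu]_(x in `]s, t[) (1.[x] * F^`().[x])).
  by apply: eq_Rintegral => x _; rewrite hornerC mul1r.
rewrite H (_ : \int[mu]_(x in _) _ = 0) ?subr0//.
rewrite -[RHS](mul0r (fine (mu `]s, t[))) -Rintegral_cst//.
by apply: eq_Rintegral => x _; rewrite horner0 mul0r.
Qed.

Lemma pint_integrable s t Q : mu.-integrable `]s, t[ (EFin \o horner Q).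
Proof. by apply: continuous_integrable_oo; exact: continuous_horner. Qed.

Lemma pintD s t F G : pint s t (F + G) = pint s t F + pint s t G.
Proof.
rewrite -RintegralD//; [|exact: pint_integrable..].
by apply: eq_Rintegral => x _; rewrite hornerD.
Qed.

Lemma pintZ s t c F : pint s t (c *: F) = c * pint s t F.
Proof.
rewrite -RintegralZl//; last exact: pint_integrable.
by apply: eq_Rintegral => x _; rewrite hornerZ.
Qed.

Lemma pint_sqr_ge0 s t F : 0 <= pint s t (F * F).
Proof. by apply: Rintegral_ge0 => x _; rewrite hornerM -expr2 sqr_ge0. Qed.

(** The source of the constant 12: with slope c and midpoint value m, the integral of Q^2 is h m^2 +
    h^3 c^2 / 12 and that of Q'^2 is h c^2. [F] and [G] are antiderivatives of these two squares. *)
Lemma inverse_inequality_linear s h Q : 0 < h -> (size Q <= 2)%N ->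
  pint s (s + h) (Q^`() * Q^`()) <= 12 / h ^+ 2 * pint s (s + h) (Q * Q).
Proof.
move=> h0 sQ; have st : s < s + h by rewrite ltrDl.
have QE : Q = (Q`_1) *: 'X + (Q`_0)%:P.
  apply/polyP => -[|[|i]]; rewrite !coefE/= ?mulr0 ?add0r ?mulr1 ?addr0//.
  by rewrite nth_default// (leq_trans sQ).
move: (Q`_1) (Q`_0) QE => c1 c0 ->.
pose F := (c1 ^+ 2 / 3) *: 'X^3 + (c0 * c1) *: 'X^2 + c0 ^+ 2 *: 'X.
have dF : F^`() = (c1 *: 'X + c0%:P) * (c1 *: 'X + c0%:P).
  rewrite /F !derivD !derivZ !derivXn derivX /= expr1.
  rewrite -(scaler_nat 3 'X^2) scalerA divfK ?pnatr_eq0//.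
  by rewrite -!mul_polyC; ring.
rewrite derivD derivZ derivX derivC addr0 -dF pint_deriv//.
pose G := (c1 ^+ 2) *: 'X : {poly R}.
have dG : (c1 *: 1) * (c1 *: 1) = G^`().
  by rewrite /G derivZ derivX -scalerAl mul1r scalerA expr2.
rewrite dG pint_deriv// /F /G !hornerE /=.
rewrite -subr_ge0.
(* The difference is 12 / h times the square of Q at the midpoint. *)
rewrite (_ : _ - _ = 12 / h * (c0 + c1 * (s + h / 2)) ^+ 2); last first.
  by field; rewrite gt_eqF.
by rewrite mulr_ge0 ?sqr_ge0// divr_ge0// ltW.
Qed.

(** The discriminant criterion: evaluate at the minimum -B / C if C > 0. *)
Lemma sqr_le_of_quadratic (A B C : R) : 0 <= C ->
  (forall x, 0 <= A + 2 * x * B + x ^+ 2 * C) -> B ^+ 2 <= A * C.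
Proof.
rewrite le_eqVlt => /predU1P[<-|C0] H.
  rewrite mulr0; have [->|B0] := eqVneq B 0; first by rewrite expr0n.
  (* With C = 0 the expression is affine in x and would take the value -1 here. *)
  have := H (- (A + 1) / (2 * B)).
  rewrite (_ : _ + _ = -1) ?ler0N1//.
  by field.
have := H (- B / C).
rewrite (_ : _ + _ = A - B ^+ 2 / C); last by field; rewrite gt_eqF.
by rewrite subr_ge0 ler_pdivrMr.
Qed.


(** Log-convexity makes the ratios E_{k+1} / E_k increase, so a bound on the last one passes down
    one index at a time. The division is by E_{k+1}; if that is 0, the bound on it is immediate. *)
Lemma ratio_descent (E : nat -> R) (c : R) q m :
  0 <= c -> (forall k, 0 <= E k) ->
  E (q + m).+1 <= c * E (q + m)%N ->
  (forall k, (q <= k < q + m)%N -> E k.+1 ^+ 2 <= E k * E k.+2) ->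
  E q.+1 <= c * E q.
Proof.
move=> c0 E0; elim: m => [|m IH] Ep H; first by rewrite addn0 in Ep.
apply: IH; last by move=> k /andP[qk km]; rewrite H// qk addnS ltnW.
rewrite addnS in Ep H; have := H (q + m)%N.
rewrite leq_addr ltnSn => /(_ isT) H1.
have := E0 (q + m).+1; rewrite le_eqVlt => /predU1P[<-|E1].
  by rewrite mulr_ge0.
rewrite -(ler_pM2r E1) -expr2; apply: le_trans H1 _.
by rewrite mulrAC mulrC; apply: ler_wpM2r.
Qed.

Variables (a h : R) (n : nat).
Local Notation node j := (a + h * j%:R).
Implicit Types f g : nat -> {poly R}.
Hypothesis h0 : 0 < h.

Definition pdot f g := \sum_(j < n) pint (node j) (node j.+1) (f j * g j).

Lemma pdot_ge0 f : 0 <= pdot f f.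
Proof. by apply: sumr_ge0 => j _; exact: pint_sqr_ge0. Qed.

(** The energy of f + x g is a nonnegative quadratic polynomial in x. *)
Lemma pdot_cauchy_schwarz f g : pdot f g ^+ 2 <= pdot f f * pdot g g.
Proof.
apply: sqr_le_of_quadratic; first exact: pdot_ge0.
move=> x; have := pdot_ge0 (fun j => f j + x *: g j).
congr (_ <= _); rewrite /pdot !mulr_sumr -!big_split/=; apply: eq_bigr => j _.
rewrite -!pintZ -!pintD; congr pint.
by rewrite -!mul_polyC; rewrite !polyCM /=; ring.
Qed.

Lemma sum_telescope_nodes f : (0 < n)%N ->
  (forall j, (j.+1 < n)%N -> (f j).[node j.+1] = (f j.+1).[node j.+1]) ->
  \sum_(j < n) ((f j).[node j.+1] - (f j).[node j]) =
  (f n.-1).[node n] - (f 0%N).[node 0].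
Proof.
case: n => // m _; elim: m => [|m IH] H.
  by rewrite big_ord_recl big_ord0 addr0.
rewrite big_ord_recr/= IH.
  by rewrite (H m)//=; ring.
by move=> j jm; rewrite H// ltnS ltnW.
Qed.

Variable P : nat -> {poly R}.
Local Notation U k := (fun j => (P j)^`(k)).

(** On each cell the two integrands add up to the derivative of the product of the derivatives of
    orders k and k + 1. This product does not jump at the nodes, so the sum telescopes to the two
    ends, where it is 0. *)
Lemma pdot_derivn_by_parts k : (0 < n)%N ->
  (forall i j, (i <= k.+1)%N -> (j.+1 < n)%N ->
    (P j)^`(i).[node j.+1] = (P j.+1)^`(i).[node j.+1]) ->
  ((P 0%N)^`(k) * (P 0%N)^`(k.+1)).[node 0] = 0 ->
  ((P n.-1)^`(k) * (P n.-1)^`(k.+1)).[node n] = 0 ->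
  pdot (U k.+1) (U k.+1) = - pdot (U k) (U k.+2).
Proof.
move=> n0 jump z0 zn; apply/eqP; rewrite -addr_eq0 -big_split/=; apply/eqP.
transitivity (\sum_(j < n) (((P j)^`(k) * (P j)^`(k.+1)).[node j.+1] -
    ((P j)^`(k) * (P j)^`(k.+1)).[node j])).
  apply: eq_bigr => j _; rewrite -pintD -pint_deriv.
    by congr pint; rewrite derivM -!derivnS.
  by rewrite ltrD2l ltr_pM2l// ltr_nat.
rewrite (@sum_telescope_nodes (fun j => (P j)^`(k) * (P j)^`(k.+1)))//.
  by rewrite z0 zn subr0.
by move=> j jn; rewrite !hornerM !jump.
Qed.

Lemma energy_inverse_inequality q p : (0 < n)%N -> (q < p)%N ->
  (forall j, (size (P j) <= p.+1)%N) ->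
  (forall i j, (i < p)%N -> (j.+1 < n)%N ->
    (P j)^`(i).[node j.+1] = (P j.+1)^`(i).[node j.+1]) ->
  (forall k, (q <= k)%N -> (k.+1 < p)%N ->
    ((P 0%N)^`(k) * (P 0%N)^`(k.+1)).[node 0] = 0 /\
    ((P n.-1)^`(k) * (P n.-1)^`(k.+1)).[node n] = 0) ->
  pdot (U q.+1) (U q.+1) <= 12 / h ^+ 2 * pdot (U q) (U q).
Proof.
move=> n0; case: p => // p qp szP jump bc.
(* After the case split the degree is [p.+1], so the descent starts at the ratio of orders [p.+1]
   and [p], where the derivative of order [p] is affine on each cell. *)
apply: (@ratio_descent (fun k => pdot (U k) (U k)) _ q (p - q)).
- by rewrite divr_ge0// sqr_ge0.
- by move=> k; exact: pdot_ge0.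
- rewrite subnKC// /pdot mulr_sumr; apply: ler_sum => j _.
  have -> : node j.+1 = node j + h by rewrite -natr1; ring.
  rewrite derivnS; apply: inverse_inequality_linear => //.
  apply/leq_sizeP => i i2; rewrite coef_derivn nth_default ?mul0rn//.
  by rewrite (leq_trans (szP j))// -addn2 leq_add2l.
- rewrite subnKC// => k /andP[qk kp].
  have [z0 zn] := bc _ qk (kp : (k.+1 < p.+1)%N).
  rewrite pdot_derivn_by_parts//; first by rewrite sqrrN pdot_cauchy_schwarz.
  by move=> i j ik; apply: jump; rewrite ltnS (leq_trans ik).
Qed.

End energy.

(** * Seminorms of splines *)

Section norms.
Context {R : realType}.
Implicit Types (a b c d h : R) (u v : R -> R) (Q : {poly R}).
Local Notation mu := (@lebesgue_measure R).

Lemma L2normE a b v : L2 a b v ->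
  L2norm a b v = (Num.sqrt (\int[mu]_(x in `]a, b[) (v x ^+ 2)))%:E.
Proof.
move=> v2; have iv := L2_integrable_sqr v2.
rewrite /L2norm unlock.
have -> : (\int[mu]_x (`|(EFin \o v \_ `]a, b[) x| `^ 2))%E =
    (\int[mu]_(x in `]a, b[) (v x ^+ 2))%:E.
  rewrite /Rintegral fineK; last exact: (integrable_fin_num _ iv).
  rewrite [RHS]integral_mkcond; apply: eq_integral => x _.
  rewrite /= !patchE; case: ifPn => _; rewrite ?normr0 /=.
    by rewrite powR_mulrn// real_normK// num_real.
  by rewrite powR0// pnatr_eq0.
rewrite poweR_EFin powR12_sqrt//.
by apply: Rintegral_ge0 => x _; exact: sqr_ge0.
Qed.

Lemma derive1n_horner_oo u Q c d : (forall x, c < x < d -> u x = Q.[x]) ->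
  forall k x, c < x < d -> derive1n k u x = Q^`(k).[x].
Proof.
move=> uQ; elim=> [|k IH] x xcd; first exact: uQ.
rewrite derive1nS derivnS derivE !derive1E; apply: near_eq_derive.
have := xcd => /andP[cx xd].
near=> y; apply: IH; apply/andP; split; near: y.
  exact: lt_nbhsr.
exact: lt_nbhsl.
Unshelve. all: by end_near. Qed.

(** This turns a one-sided limit in [spline_bc] into a root of a derivative of the end piece, by
    continuity of polynomials and uniqueness of limits. *)
Lemma derivn_root_right u Q c d k :
  c < d -> (forall x, c < x < d -> u x = Q.[x]) ->
  derive1n k u x @[x --> c^'+] --> (0 : R) -> Q^`(k).[c] = 0.
Proof.
move=> cd uQ H; apply: (@cvg_unique R _ (Q^`(k).[x] @[x --> c^'+])).
- exact: Rhausdorff.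
- by apply: cvg_at_right_filter; exact: continuous_horner.
- apply: cvg_trans H; apply: near_eq_cvg; near=> x.
  apply: (derive1n_horner_oo uQ); apply/andP.
  by split; near: x; [exact: nbhs_right_gt|exact: nbhs_right_lt].
Unshelve. all: by end_near. Qed.

Lemma derivn_root_left u Q c d k :
  c < d -> (forall x, c < x < d -> u x = Q.[x]) ->
  derive1n k u x @[x --> d^'-] --> (0 : R) -> Q^`(k).[d] = 0.
Proof.
move=> cd uQ H; apply: (@cvg_unique R _ (Q^`(k).[x] @[x --> d^'-])).
- exact: Rhausdorff.
- by apply: cvg_at_left_filter; exact: continuous_horner.
- apply: cvg_trans H; apply: near_eq_cvg; near=> x.
  apply: (derive1n_horner_oo uQ); apply/andP.
  by split; near: x; [exact: nbhs_left_gt|exact: nbhs_left_lt].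
Unshelve. all: by end_near. Qed.

Lemma sobolev_derivativeP a b r u : sobolev a b r u ->
  L2 a b (sobolev_derivative a b r u) /\
  weak_derivative a b r u (sobolev_derivative a b r u).
Proof.
move=> [_ /(_ r (leqnn r))[v v2 wv]].
apply: (@xgetPex _ (cst 0) [set v | L2 a b v /\ weak_derivative a b r u v]).
by exists v.
Qed.

(** The value depends on the pieces alone, so it does not matter which representative
    [sobolev_derivative] picks. *)
Lemma L2norm_weak_derivative a h n u (P : nat -> {poly R}) k v : 0 < h ->
  (forall j, (j < n)%N -> forall x,
    a + h * j%:R < x <= a + h * j.+1%:R -> u x = (P j).[x]) ->
  L2 a (a + h * n%:R) v -> weak_derivative a (a + h * n%:R) k u v ->
  L2norm a (a + h * n%:R) v =
  (Num.sqrt (pdot a h n (fun j => (P j)^`(k)) (fun j => (P j)^`(k))))%:E.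
Proof.
move=> h0 uP v2 wv; rewrite L2normE// Rintegral_cells//; last first.
  exact: L2_integrable_sqr.
congr (Num.sqrt _)%:E; apply: eq_bigr => j _.
have jn := ltn_ord j.
apply: ae_eq_Rintegral => //.
- apply: measurable_funX.
  by apply: measurable_funS (L2_measurable v2) => //; exact: subset_nodes.
- apply: measurable_funTS; apply: continuous_measurable_fun.
  exact: continuous_horner.
- apply: ae_imply (weak_derivative_cell h0 uP v2 wv jn) => x H /H ->.
  by rewrite hornerM expr2.
Qed.

End norms.

(* |u|_{H^q} is defined only for u in H^q(a, b); the hypothesis
   sobolev a b q u is automatic for q <= p (lemma spline_sobolev) and only
   matters for q = p + 1. *)
Theorem theorem6 (R : realType) (a b : R) (hab : a < b)
    (h : R) (hh : grid_size a b h)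
    (q p : nat) (hp : (0 < p)%N) (hq : (0 < q <= p.+1)%N)
    (u : R -> R) (hu : spline_bc a b h q p u) (huq : sobolev a b q u) :
  (sobolev_seminorm a b q u <=
     (2 * Num.sqrt 3 * h^-1)%:E * sobolev_seminorm a b q.-1 u)%E.
Proof.
have [h0 [n n0 hn]] := hh.
have bE : b = a + h * n%:R by rewrite -hn mulVKf ?gt_eqF// addrC subrK.
have [[[u2 wd] pieces] bc] := hu.
have /choice[P HP] : forall j, exists Q : {poly R}, (size Q <= p.+1)%N /\
    ((j < n)%N -> forall x, a + h * j%:R < x <= a + h * j.+1%:R -> u x = Q.[x]).
  (* Beyond the last cell the piece is 0 by default, so that the degree bound holds for every
     [j]. *)
  move=> j; case: (ltnP j n) => jn; last by exists 0; rewrite size_poly0.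
  have [|Q sQ uQ] := pieces j; first by rewrite hn ltr_nat.
  by exists Q.
have szP j : (size (P j) <= p.+1)%N by have [] := HP j.
have uP j : (j < n)%N -> forall x,
    a + h * j%:R < x <= a + h * j.+1%:R -> u x = (P j).[x] by have [] := HP j.
have [q0 qp1] := andP hq.
have sq1 : sobolev a b q.-1 u.
  case: huq => _ wq; split => // k kq; apply: wq.
  exact: leq_trans kq (leq_pred _).
have [v2 wv] := sobolev_derivativeP huq.
have [w2 ww] := sobolev_derivativeP sq1.
rewrite /sobolev_seminorm.
move: u2 wd v2 wv w2 ww bc {hab hn hh hu huq sq1 pieces}.
rewrite bE => u2 wd v2 wv w2 ww bc.
rewrite (L2norm_weak_derivative h0 uP v2 wv).
rewrite (L2norm_weak_derivative h0 uP w2 ww).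
have C0 : 0 <= 2 * Num.sqrt 3 * h^-1 :> R.
  by rewrite !mulr_ge0 ?sqrtr_ge0// invr_ge0 ltW.
rewrite -EFinM lee_fin.
move: qp1; rewrite leq_eqVlt => /predU1P[qE|qp].
  (* For q = p + 1 the left-hand energy is 0, since pieces of degree at most p have zero derivative
     of order p + 1. *)
  rewrite [X in Num.sqrt X]big1 => [|j _].
    by rewrite sqrtr0 mulr_ge0// sqrtr_ge0.
  by rewrite qE derivn_poly0// mul0r -(scale0r (0 : {poly R})) pintZ mul0r.
(* The constant moves under the square root, where it becomes 12 / h^2. *)
rewrite -[_ * h^-1](ger0_norm C0) -sqrtr_sqr -sqrtrM ?sqr_ge0//.
apply: ler_wsqrtr.
rewrite !exprMn sqr_sqrtr ?ler0n// exprVn (_ : 2 ^+ 2 * 3 = 12); last by ring.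
(* From here on the order in the statement is [q.+1], so the boundary conditions concern the orders
   q + 1, q + 3, ... below p. *)
case: q q0 hq qp v2 wv w2 ww bc => // q _ hq qp v2 wv w2 ww bc.
apply: (@energy_inverse_inequality R a h n h0 P q p n0 qp szP).
  move=> i j ip jn; apply: (spline_jump h0 u2 uP jn _ ip) => l /andP[_ lp].
  exact: wd.
have h1 : a < a + h by rewrite ltrDl.
have uP0 x : a < x < a + h -> u x = (P 0%N).[x].
  by move=> /andP[ax xh]; rewrite (uP 0%N n0)// mulr0 addr0 mulr1 ax ltW.
have nn : a + h * n.-1%:R < a + h * n%:R.
  by rewrite ltrD2l ltr_pM2l// ltr_nat prednK.
have uPn x : a + h * n.-1%:R < x < a + h * n%:R -> u x = (P n.-1).[x].
  move=> /andP[ax xh]; rewrite (uP n.-1 _)//; first by rewrite prednK.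
  by rewrite prednK// ax ltW.
have zero l : (2 * l + q.+1 < p)%N ->
    (P 0%N)^`(2 * l + q.+1).[a] = 0 /\
    (P n.-1)^`(2 * l + q.+1).[a + h * n%:R] = 0.
  move=> /bc[ba bb]; split.
    exact: (derivn_root_right h1 uP0).
  exact: (derivn_root_left nn uPn).
move=> k qk kp; rewrite mulr0 addr0 !hornerM.
(* One of the consecutive orders k and k + 1 has the parity of q + 1: it is k if k - q is odd and k
   + 1 otherwise. That factor of the product vanishes at both ends. *)
have [l [kE|kE]] : exists l, k = (2 * l + q.+1)%N \/ k.+1 = (2 * l + q.+1)%N.
  exists (k - q)./2; rewrite mul2n; have := odd_double_half (k - q).
  case: (odd _) => /= E.
    by left; rewrite addnS -addSn -add1n E subnK.
  by right; rewrite addnS -[(_./2.*2)%N]add0n E subnK.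
- have [|z0 zn] := zero l; first by rewrite -kE ltnW.
  by rewrite kE z0 zn !mul0r.
- have [|z0 zn] := zero l; first by rewrite -kE.
  by rewrite kE z0 zn !mulr0.
Qed.
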